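(* (Quantized subspace characterization) Let $M>N$, let $\boldsymbol V\in\mathbb C^{M\times N}$ be a subspace matrix ($\boldsymbol V^H\boldsymbol V=\boldsymbol I_N$), and let $\widehat{\boldsymbol V}\in\mathbb C^{M\times N}$ be its quantization based on subspace quantization (see context). Then $\widehat{\boldsymbol V}$ can be characterized as $$\widehat{\boldsymbol V}=\boldsymbol V\boldsymbol R\boldsymbol\Gamma^{1/2}\boldsymbol G^H+\boldsymbol V^{\perp}\boldsymbol S(\boldsymbol I_N-\boldsymbol\Gamma)^{1/2}\boldsymbol G^H,$$ where $\boldsymbol V^{\perp}\in\mathbb C^{M\times(M-N)}$ spans the left null space of $\boldsymbol V$, $\boldsymbol\Gamma=\mathrm{diag}\{\alpha_1,\dots,\alpha_N\}$ with $\alpha_j\in(0,1)$ and $\sum_{j=1}^N\alpha_j=N-d_c^2(\widehat{\boldsymbol V},\boldsymbol V)$, and $\boldsymbol R\in\mathbb C^{N\times N}$, $\boldsymbol G\in\mathbb C^{N\times N}$ and $\boldsymbol S\in\mathbb C^{(M-N)\times N}$ satisfy $\boldsymbol R^H\boldsymbol R=\boldsymbol G^H\boldsymbol G=\boldsymbol S^H\boldsymbol S=\boldsymbol I_N$.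
   Context: A codebook with $B$ bits is a finite set $\mathcal C=\{\boldsymbol C_n\in\mathbb C^{M\times N}:\boldsymbol C_n^H\boldsymbol C_n=\boldsymbol I_N,\ n=1,\dots,2^B\}$. For $\boldsymbol V,\boldsymbol W\in\mathbb C^{M\times N}$ with orthonormal columns, the squared chordal distance is $d_c^2(\boldsymbol V,\boldsymbol W)=N-\mathrm{Tr}(\boldsymbol V\boldsymbol V^H\boldsymbol W\boldsymbol W^H)$. Subspace quantization maps $\boldsymbol V$ to the closest codeword, $\widehat{\boldsymbol V}=\arg\min_{\boldsymbol C_n\in\mathcal C}d_c^2(\boldsymbol V,\boldsymbol C_n)$. The matrix $\boldsymbol V^{\perp}$ consists of the (orthonormal) eigenvectors associated with the zero eigenvalues of $\boldsymbol V\boldsymbol V^H$, so that $(\boldsymbol V^{\perp})^H\boldsymbol V=\boldsymbol 0$.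
   Formalization: α_j in (0,1) fails if V is a codeword; SᴴS=I fails if M<2N. Proved: always α_j in [0,1] and SᴴS(I−Γ)=I−Γ; SᴴS=I if M≥2N; both original claims when no principal angle between V and its quantization is 0 or π/2 (also necessary). *)

(* Defs.v *)
From mathcomp Require Import all_boot all_order all_algebra.
From mathcomp Require Import complex reals.
Set Implicit Arguments.
Unset Strict Implicit.
Unset Printing Implicit Defensive.
Import Order.TTheory GRing.Theory Num.Theory.
Local Open Scope ring_scope.
Local Open Scope sesquilinear_scope.
Local Open Scope complex_scope.

(* [A ^t*] is the conjugate transpose of A. The predicate [unitarymx] of
   spectral.v is not used because it is about orthonormal rows. *)
Definition orthonormal_cols (R : realType) (M N : nat) (A : 'M[R[i]]_(M, N)) :
  Prop := A ^t* *m A = 1%:M.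

(* The value is a complex number whose imaginary part vanishes (the trace of a
   product of two Hermitian matrices is real), so that the order of R[i] used
   to compare two distances is the order of the reals. *)
Definition chordal2 (R : realType) (M N : nat) (V W : 'M[R[i]]_(M, N)) : R[i] :=
  N%:R - \tr (V *m V ^t* *m (W *m W ^t*)).

(* A codebook with B bits is an indexed family of 2^B codewords. *)
Definition codebook (R : realType) (M N B : nat)
    (Cb : 'I_(2 ^ B) -> 'M[R[i]]_(M, N)) : Prop :=
  forall n, orthonormal_cols (Cb n).

(* Ties are allowed: Vh is any of the closest codewords. *)
Definition subspace_quantization (R : realType) (M N B : nat)
    (Cb : 'I_(2 ^ B) -> 'M[R[i]]_(M, N)) (V Vh : 'M[R[i]]_(M, N)) : Prop :=
  exists2 n, Vh = Cb n & forall m, chordal2 V (Cb n) <= chordal2 V (Cb m).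

(* The M - N columns of Vp are orthonormal eigenvectors of V V^H for the
   eigenvalue 0. *)
Definition null_eigenvectors (R : realType) (M N : nat)
    (V : 'M[R[i]]_(M, N)) (Vp : 'M[R[i]]_(M, M - N)) : Prop :=
  orthonormal_cols Vp /\ V *m V ^t* *m Vp = 0.

(* No principal angle between the column spans of V and W is 0 or pi/2: a
   vector W x in the span of W that is orthogonal to the span of V, or belongs
   to it, is zero (W being injective). This forces 2 N <= M. *)
Definition general_position (R : realType) (M N : nat)
    (V W : 'M[R[i]]_(M, N)) : Prop :=
  (forall x : 'cV[R[i]]_N, V ^t* *m (W *m x) = 0 -> x = 0) /\
  (forall x y : 'cV[R[i]]_N, W *m x = V *m y -> x = 0).

Definition real_diag (R : realType) (N : nat) (a : 'I_N -> R) : 'M[R[i]]_N :=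
  diag_mx (\row_j (a j)%:C).

(* Main.v *)
(** Since [V Vp] is unitary, Vh = V A + Vp X with A = V^H Vh and X = Vp^H Vh,
    and A^H A + X^H X = I. A unitary G that diagonalizes A^H A, with eigenvalues
    alpha_j, therefore also diagonalizes X^H X, with eigenvalues 1 - alpha_j; so
    the columns of A G, and those of X G, are pairwise orthogonal with these
    squared norms. Normalizing them gives Rm and S; the columns that vanish are
    replaced by an orthonormal completion when the dimension leaves room. *)

Require Import Defs.
From mathcomp Require Import all_boot all_order all_algebra.
From mathcomp Require Import complex reals.
Set Implicit Arguments.
Unset Strict Implicit.
Unset Printing Implicit Defensive.
Import Order.TTheory GRing.Theory Num.Theory.
Local Open Scope ring_scope.
Local Open Scope sesquilinear_scope.
Local Open Scope complex_scope.

Lemma adjmxM (C : numClosedFieldType) (m n p : nat) (A : 'M[C]_(m, n))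
    (B : 'M[C]_(n, p)) : (A *m B) ^t* = B ^t* *m A ^t*.
Proof. by rewrite trmx_mul map_mxM. Qed.

Lemma adjmxD (C : numClosedFieldType) (m n : nat) (A B : 'M[C]_(m, n)) :
  (A + B) ^t* = A ^t* + B ^t*.
Proof. by rewrite linearD /= map_mxD. Qed.

Lemma adj_real_diag (R : realType) (n : nat) (a : 'I_n -> R) :
  (real_diag a) ^t* = real_diag a.
Proof.
apply/matrixP=> i j; rewrite !mxE [j == i]eq_sym.
case: eqVneq => [->|_]; rewrite ?mulr0n ?rmorph0 // !mulr1n.
by apply/eqP; rewrite eq_complex /= oppr0 !eqxx.
Qed.

Lemma mul_real_diag (R : realType) (n : nat) (a b : 'I_n -> R) :
  real_diag a *m real_diag b = real_diag (fun j => a j * b j).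
Proof.
rewrite /real_diag mulmx_diag; congr diag_mx.
by apply/rowP=> j; rewrite !mxE rmorphM.
Qed.

Lemma eq_real_diag (R : realType) (n : nat) (a b : 'I_n -> R) :
  a =1 b -> real_diag a = real_diag b.
Proof.
by move=> eq_ab; congr diag_mx; apply/rowP=> j; rewrite !mxE eq_ab.
Qed.

Lemma real_diag1 (R : realType) (n : nat) :
  real_diag (fun _ : 'I_n => 1 : R) = 1%:M.
Proof. by apply/matrixP=> i j; rewrite !mxE. Qed.

Lemma real_diagB (R : realType) (n : nat) (a b : 'I_n -> R) :
  real_diag (fun j => a j - b j) = real_diag a - real_diag b.
Proof.
apply/matrixP=> i j; rewrite !mxE rmorphB.
by case: eqP => _; rewrite ?mulr1n // !mulr0n subr0.
Qed.

Lemma gram_diagE (R : realType) (m n : nat) (X : 'M[R[i]]_(m, n))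
    (a : 'I_n -> R) (j : 'I_n) :
  X ^t* *m X = real_diag a -> (a j)%:C = \sum_i `|X i j| ^+ 2.
Proof.
move=> /matrixP/(_ j j); rewrite !mxE eqxx mulr1n => <-.
by apply: eq_bigr => i _; rewrite !mxE normCK mulrC.
Qed.

Lemma gram_diag_ge0 (R : realType) (m n : nat) (X : 'M[R[i]]_(m, n))
    (a : 'I_n -> R) (j : 'I_n) : X ^t* *m X = real_diag a -> 0 <= a j.
Proof.
move=> /gram_diagE-/(_ j) aE.
have: 0 <= (a j)%:C by rewrite aE sumr_ge0 // => i _; rewrite exprn_ge0.
by rewrite lecE /= => /andP[].
Qed.

Lemma gram_diag_eq0 (R : realType) (m n : nat) (X : 'M[R[i]]_(m, n))
    (a : 'I_n -> R) (j : 'I_n) :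
  X ^t* *m X = real_diag a -> a j = 0 -> col j X = 0.
Proof.
move=> /gram_diagE-/(_ j) aE a0; move: aE; rewrite a0 rmorph0 => /esym/eqP.
rewrite psumr_eq0 => [/allP X0|i _]; last by rewrite exprn_ge0.
apply/colP=> i; rewrite !mxE; have := X0 i (mem_index_enum i).
by rewrite /= sqrf_eq0 normr_eq0 => /eqP.
Qed.

(** If the left kernel of [X] were trivial, [X] would have rank [m], so [m = n] and [X] would be
    invertible, which its zero column [j] forbids. A nonzero row of that kernel, normalized and
    conjugate-transposed, is [u]. *)
Lemma exists_unit_orthogonal (R : realType) (m n : nat) (X : 'M[R[i]]_(m, n))
    (j : 'I_n) : (n <= m)%N -> col j X = 0 ->
  exists2 u : 'cV[R[i]]_m, u ^t* *m u = 1%:M & u ^t* *m X = 0.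
Proof.
move=> le_nm X0.
have [v vX v0] : exists2 v : 'rV[R[i]]_m, v *m X = 0 & v != 0.
  have [|kX0] := altP (kermx X =P 0).
    move=> /eqP; rewrite kermx_eq0 /row_free => /eqP rX.
    have eq_mn : n = m.
      by apply/eqP; rewrite eqn_leq le_nm -{1}rX rank_leq_col.
    have uX : row_free X^T by rewrite /row_free mxrank_tr rX eq_mn.
    have : (delta_mx 0 j : 'rV_n) *m X^T = 0.
      by rewrite -rowE -tr_col X0 trmx0.
    rewrite -(mul0mx _ X^T) => /(row_free_inj uX)/matrixP/(_ 0 j)/eqP.
    by rewrite !mxE !eqxx oner_eq0.
  exists (nz_row (kermx X)); last by rewrite nz_row_eq0.
  by apply/sub_kermxP/nz_row_sub.
pose s := sqrtC ((v *m v ^t*) 0 0).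
have vv : (v *m v ^t*) 0 0 = \sum_i `|v 0 i| ^+ 2.
  by rewrite mxE; apply: eq_bigr => i _; rewrite !mxE normCK.
have vv_ge0 : 0 <= (v *m v ^t*) 0 0.
  by rewrite vv sumr_ge0 // => i _; rewrite exprn_ge0.
have vv_neq0 : (v *m v ^t*) 0 0 != 0.
  apply: contraNneq v0; rewrite vv => /eqP.
  rewrite psumr_eq0 => [/allP v0|i _]; last by rewrite exprn_ge0.
  apply/eqP/rowP=> i; rewrite !mxE; have := v0 i (mem_index_enum i).
  by rewrite /= sqrf_eq0 normr_eq0 => /eqP.
have s_neq0 : s != 0 by rewrite sqrtC_eq0.
have s_real : Num.conj s = s by apply: CrealP; rewrite ger0_real // sqrtC_ge0.
have uE : ((s^-1 *: v) ^t*) ^t* = s^-1 *: v by rewrite trmxCK.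
exists ((s^-1 *: v) ^t*); rewrite uE; last by rewrite -scalemxAl vX scaler0.
rewrite linearZ /= map_mxZ fmorphV.
rewrite [X in _ *m (X^-1 *: _)]s_real -scalemxAl -scalemxAr scalerA.
rewrite [v *m _]mx11_scalar -scalemx1 scalerA -invfM -expr2 sqrtCK mulVf //.
by rewrite scale1r.
Qed.

(* [X] has orthonormal columns at the indices satisfying [e] and zero columns
   elsewhere; the zero columns are replaced one by one. *)
Lemma complete_orthonormal_cols (R : realType) (m n : nat)
    (X : 'M[R[i]]_(m, n)) (e : pred 'I_n) : (n <= m)%N ->
    X ^t* *m X = real_diag (fun j => (e j)%:R : R) ->
  exists2 S : 'M[R[i]]_(m, n), orthonormal_cols S &
    forall j, e j -> col j S = col j X.
Proof.
move=> le_nm; have [k] := ubnP #|predC e|.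
elim: k => // k IHk in X e *; rewrite ltnS => le_ek gramX.
case: (pickP (predC e)) => [j /= ne_j|e1]; last first.
  exists X => //; rewrite /orthonormal_cols gramX -real_diag1.
  by apply: eq_real_diag => j; have /negbFE -> := e1 j.
have X0 : col j X = 0 by apply: gram_diag_eq0 gramX _; rewrite (negPf ne_j).
have [u uu uX] := exists_unit_orthogonal le_nm X0.
have Xu : X ^t* *m u = 0 by rewrite -[u]trmxCK -adjmxM uX trmx0 map_mx0.
(* Column [j] of [X] is zero, so this puts [u] in its place. As [u] is a unit vector orthogonal to
   all columns of [X], the Gram matrix only gains a 1 at position [(j, j)]. *)
pose Y := X + u *m (delta_mx 0 j : 'rV_n).
have YE i : i != j -> col i Y = col i X.
  move=> ne_ij; rewrite /Y linearD /= [col i (_ *m _)]colE -mulmxA -colE.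
  suff -> : col i (delta_mx 0 j : 'rV[R[i]]_n) = 0 by rewrite mulmx0 addr0.
  by apply/matrixP=> a b; rewrite !mxE (negPf ne_ij) andbF.
have [||S Son SX] := IHk Y (predU1 j e).
- apply: leq_trans le_ek; apply: proper_card; apply/properP; split.
    by apply/subsetP=> i; rewrite !inE /= negb_or => /andP[].
  by exists j; rewrite !inE /= ?eqxx.
- rewrite /Y adjmxD adjmxM mulmxDl !mulmxDr gramX.
  rewrite [X in _ + X + _]mulmxA Xu mul0mx addr0.
  rewrite -[X in _ + (X + _)]mulmxA uX mulmx0 add0r.
  rewrite -mulmxA [X in _ + _ *m X]mulmxA uu mul1mx.
  apply/matrixP=> a b; rewrite !mxE big_ord1 !mxE /= rmorph_nat.
  rewrite !rmorph_nat -!mulrnA -natrM -natrD; congr _%:R.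
  case: (eqVneq a b) => [->|ne_ab].
    by case: eqVneq => [->|_]; rewrite ?(negPf ne_j) //= muln1 addn0.
  rewrite !muln0 add0n; case: (eqVneq a j) ne_ab => // -> ne_jb.
  by rewrite eq_sym (negPf ne_jb).
exists S => // i ei; rewrite SX /= ?ei ?orbT // YE //.
by apply: contraNneq ne_j => <-.
Qed.

Lemma col_mul_real_diag (R : realType) (m n : nat) (X : 'M[R[i]]_(m, n))
    (a : 'I_n -> R) (j : 'I_n) :
  col j (X *m real_diag a) = (a j)%:C *: col j X.
Proof. by rewrite mul_mx_diag; apply/colP=> i; rewrite !mxE mulrC. Qed.

Lemma gram_mulmx_real_diag (R : realType) (m n : nat) (X : 'M[R[i]]_(m, n))
    (a : 'I_n -> R) :
  (X *m real_diag a) ^t* *m (X *m real_diag a) =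
  real_diag a *m (X ^t* *m X) *m real_diag a.
Proof. by rewrite adjmxM adj_real_diag !mulmxA. Qed.

(** The second conclusion is what remains of orthonormality when [m < n]: the columns of [S] where
    [a] is nonzero are orthonormal, and [real_diag a] kills the others. *)
Lemma normalize_cols (R : realType) (m n : nat) (X : 'M[R[i]]_(m, n))
    (a : 'I_n -> R) : X ^t* *m X = real_diag a ->
  exists S : 'M[R[i]]_(m, n),
    [/\ X = S *m real_diag (fun j => Num.sqrt (a j)),
        S ^t* *m S *m real_diag a = real_diag a &
        (n <= m)%N -> orthonormal_cols S].
Proof.
move=> gramX; have a_ge0 j : 0 <= a j by apply: gram_diag_ge0 gramX.
have sqrt_neq0 j : a j != 0 -> Num.sqrt (a j) != 0.
  by rewrite sqrtr_eq0 -ltNge lt_def a_ge0 andbT.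
pose e : pred 'I_n := [pred j | a j != 0].
pose S0 := X *m real_diag (fun j => (Num.sqrt (a j))^-1).
have gramS0 : S0 ^t* *m S0 = real_diag (fun j => (e j)%:R : R).
  rewrite gram_mulmx_real_diag gramX !mul_real_diag; apply: eq_real_diag => j.
  rewrite /e /=; have [->|a0] := eqVneq (a j) 0; first by rewrite mulr0 mul0r.
  by rewrite -{2}(sqr_sqrtr (a_ge0 j)) expr2 mulKf ?mulfV ?sqrt_neq0.
(* Columns of [S] where [a] vanishes are free: they get the factor 0, and the matching columns of
   [X] are zero. *)
have factorX (S : 'M[R[i]]_(m, n)) : (forall j, e j -> col j S = col j S0) ->
    X = S *m real_diag (fun j => Num.sqrt (a j)).
  move=> eq_SS0.
  suff cX j : col j X = col j (S *m real_diag (fun j => Num.sqrt (a j))).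
    by apply/matrixP=> i j; have /colP/(_ i) := cX j; rewrite !mxE.
  rewrite col_mul_real_diag; have [a0|a0] := eqVneq (a j) 0.
    by rewrite a0 sqrtr0 scale0r; apply: gram_diag_eq0 gramX a0.
  by rewrite eq_SS0 // col_mul_real_diag scalerA -rmorphM mulfV ?scale1r ?sqrt_neq0.
have [le_nm|lt_mn] := leqP n m.
  have [S Son SS0] := complete_orthonormal_cols le_nm gramS0.
  by exists S; split; [apply: factorX | rewrite Son mul1mx | ].
(* [S0] has zero columns where [a] vanishes, since [0^-1 = 0]. *)
exists S0; split=> //; first exact: factorX.
rewrite gramS0 mul_real_diag; apply: eq_real_diag => j.
by rewrite /e /=; case: eqVneq => [->|_]; rewrite ?mulr0 ?mul1r.
Qed.

(** The Gram matrix of [A] is Hermitian, hence normal, and the spectral theorem applies. *)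
Lemma diagonalize_gram (R : realType) (m n : nat) (A : 'M[R[i]]_(m, n)) :
  exists (G : 'M[R[i]]_n) (a : 'I_n -> R),
    orthonormal_cols G /\ (A *m G) ^t* *m (A *m G) = real_diag a.
Proof.
pose H := A ^t* *m A.
have Hadj : H ^t* = H by rewrite /H adjmxM trmxCK.
have /orthomx_spectralP HE : H \is normalmx by apply/normalmxP; rewrite Hadj.
have uP := spectral_unitarymx H.
rewrite (invmx_unitary uP) in HE.
set P := spectralmx H in HE uP; set d := spectral_diag H in HE.
have PP : P *m P ^t* = 1%:M by apply/unitarymxP.
have gramE : (A *m P ^t*) ^t* *m (A *m P ^t*) = diag_mx d.
  rewrite adjmxM trmxCK mulmxA -[P *m _ *m A]mulmxA -/H HE.
  by rewrite !mulmxA PP mul1mx -mulmxA PP mulmx1.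
(* The spectral theorem yields complex eigenvalues. Taking real parts loses nothing, since they are
   diagonal entries of a Gram matrix, i.e. sums of squared moduli. *)
exists (P ^t*), (fun j => complex.Re (d 0 j)); split.
  by rewrite /orthonormal_cols trmxCK.
rewrite gramE; congr diag_mx; apply/rowP=> j; rewrite mxE.
have /matrixP/(_ j j) := gramE; rewrite !mxE eqxx mulr1n => <-.
rewrite RRe_real // ger0_real // sumr_ge0 // => i _.
by rewrite !mxE mulrC mul_conjC_ge0.
Qed.

(** The block matrix [[V Vp]] is square with orthonormal columns, so its adjoint is also a right
    inverse. *)
Lemma null_eigenvectors_complement (R : realType) (M N : nat)
    (V : 'M[R[i]]_(M, N)) (Vp : 'M[R[i]]_(M, M - N)) : (N <= M)%N ->
    orthonormal_cols V -> null_eigenvectors V Vp ->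
  V *m V ^t* + Vp *m Vp ^t* = 1%:M.
Proof.
move=> le_NM hV [hVp VVp0]; move: {le_NM}(subnKC le_NM) Vp hVp VVp0.
(* With [M - N] generalized to [K], [M] can be replaced by [N + K], which makes the block matrix
   square by its type. *)
move: (M - N)%N => K eqM Vp hVp VVp0.
have VVp : V ^t* *m Vp = 0.
  by rewrite -[V ^t*]mul1mx -hV -2!mulmxA [X in _ *m X]mulmxA VVp0 mulmx0.
have VpV : Vp ^t* *m V = 0 by rewrite -[V]trmxCK -adjmxM VVp trmx0 map_mx0.
case: M / eqM V Vp hV hVp VVp VpV {VVp0} => V Vp hV hVp VVp VpV.
rewrite -mul_row_col; apply: mulmx1C.
by rewrite mul_col_row hV hVp VVp VpV -scalar_mx_block.
Qed.

(** If [a j] were 0, column [j] of [A *m G] would vanish, hence by injectivity also column [j] of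
    [G], which is a unit vector. *)
Lemma gram_col_gt0 (R : realType) (m n : nat) (A : 'M[R[i]]_(m, n))
    (G : 'M[R[i]]_n) (a : 'I_n -> R) (j : 'I_n) :
    (forall x : 'cV_n, A *m x = 0 -> x = 0) -> orthonormal_cols G ->
  (A *m G) ^t* *m (A *m G) = real_diag a -> 0 < a j.
Proof.
move=> injA hG gramAG; rewrite lt_def (gram_diag_ge0 _ gramAG) andbT.
apply/eqP=> a0; have /injA G0 : A *m col j G = 0.
  by rewrite colE mulmxA -colE (gram_diag_eq0 gramAG a0).
have /matrixP/(_ j 0) : G ^t* *m col j G = delta_mx j 0.
  by rewrite colE mulmxA hG mul1mx.
by rewrite G0 mulmx0 !mxE !eqxx => /esym/eqP; rewrite oner_eq0.
Qed.

(** The bounds on [alpha] are closed in general: if [V] is itself a codeword, the distance is 0 and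
    every [alpha j] is 1. Likewise [S] has more columns than rows when [M < 2 * N], so only a
    weighted orthonormality is claimed there. *)
Theorem lemma3 (R : realType) (M N B : nat) (hMN : (N < M)%N)
    (V : 'M[R[i]]_(M, N)) (hV : orthonormal_cols V)
    (Cb : 'I_(2 ^ B) -> 'M[R[i]]_(M, N)) (hCb : codebook Cb)
    (Vh : 'M[R[i]]_(M, N)) (hVh : subspace_quantization Cb V Vh)
    (Vp : 'M[R[i]]_(M, M - N)) (hVp : null_eigenvectors V Vp) :
  exists (alpha : 'I_N -> R) (Rm G : 'M[R[i]]_N) (S : 'M[R[i]]_(M - N, N)),
    Vh = V *m Rm *m real_diag (fun j => Num.sqrt (alpha j)) *m G ^t*
         + Vp *m S *m real_diag (fun j => Num.sqrt (1 - alpha j)) *m G ^t* /\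
    (\sum_j alpha j)%:C = N%:R - chordal2 Vh V /\
    orthonormal_cols Rm /\
    orthonormal_cols G /\
    (forall j, 0 <= alpha j <= 1) /\
    S ^t* *m S *m (1%:M - real_diag alpha) = 1%:M - real_diag alpha /\
    ((2 * N <= M)%N -> orthonormal_cols S) /\
    (general_position V Vh ->
       (forall j, 0 < alpha j < 1) /\ orthonormal_cols S).
Proof.
have hVh1 : orthonormal_cols Vh by case: hVh => n -> _; apply: hCb.
have resI := null_eigenvectors_complement (ltnW hMN) hV hVp.
(* [A] and [X] are the coordinates of [Vh] in the orthonormal basis [[V Vp]], kept opaque behind
   equations. *)
have [A AE] : {A | A = V ^t* *m Vh} by exists (V ^t* *m Vh).
have [X XE] : {X | X = Vp ^t* *m Vh} by exists (Vp ^t* *m Vh).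
have VhE : V *m A + Vp *m X = Vh.
  by rewrite AE XE !mulmxA -mulmxDl resI mul1mx.
have gramAX : A ^t* *m A + X ^t* *m X = 1%:M.
  rewrite AE XE !adjmxM !trmxCK -!mulmxA -mulmxDr !mulmxA -mulmxDl resI.
  by rewrite mul1mx.
have [G [alpha [hG gramAG]]] := diagonalize_gram A.
have hG' : G *m G ^t* = 1%:M by apply: mulmx1C.
have betaE : real_diag (fun j => 1 - alpha j) = 1%:M - real_diag alpha.
  by rewrite real_diagB real_diag1.
have gramXG : (X *m G) ^t* *m (X *m G) = real_diag (fun j => 1 - alpha j).
  rewrite betaE -gramAG; apply/eqP; rewrite eq_sym subr_eq addrC; apply/eqP.
  rewrite !adjmxM -!mulmxA -mulmxDr !mulmxA -mulmxDl gramAX mul1mx.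
  by rewrite hG.
(* [A *m G] is square, so the completion always has room; for [S] it needs [N <= M - N]. *)
have [Rm [RmE _ /(_ (leqnn N)) hRm]] := normalize_cols gramAG.
have [S [SE gramS hS]] := normalize_cols gramXG.
have alpha01 j : 0 <= alpha j <= 1.
  by rewrite (gram_diag_ge0 _ gramAG) -subr_ge0 (gram_diag_ge0 _ gramXG).
exists alpha, Rm, G, S; rewrite -betaE; split; last split; last do 5 (split=> //).
- rewrite -2!(mulmxA V) -RmE -2!(mulmxA Vp) -SE.
  by rewrite -!mulmxA hG' !mulmx1 -{1}VhE.
(* By cyclicity the trace is that of [A ^t* *m A]; inserting [G *m G ^t*] turns it into the trace of
   [real_diag alpha]. *)
- rewrite /chordal2 opprB addrC subrK -(mulmxA Vh) mxtrace_mulC.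
  have -> : Vh ^t* *m (V *m V ^t*) *m Vh = A ^t* *m A.
    by rewrite AE adjmxM trmxCK !mulmxA.
  rewrite -[A ^t* *m A]mulmx1 -hG' mulmxA mxtrace_mulC !mulmxA -adjmxM.
  rewrite -mulmxA gramAG mxtrace_diag rmorph_sum.
  by apply: eq_bigr => j _; rewrite mxE.
- by move=> le_2NM; apply: hS; rewrite leq_subRL ?(ltnW hMN) // addnn -mul2n.
- move=> [injA injV].
  have alpha_gt0 j : 0 < alpha j.
    by apply: (gram_col_gt0 _ _ hG gramAG) => x; rewrite AE -mulmxA => /injA.
  have beta_gt0 j : 0 < 1 - alpha j.
    (* [X] is injective: if [X *m x = 0], then [Vh *m x = V *m (A *m x)] lies in the span of [V]. *)
    apply: (gram_col_gt0 _ _ hG gramXG) => x Xx0; apply: (injV x (A *m x)).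
    by rewrite -{1}VhE mulmxDl -!mulmxA Xx0 mulmx0 addr0.
  split=> [j|]; first by rewrite alpha_gt0 -subr_gt0 beta_gt0.
  (* All weights [1 - alpha j] are now invertible, so they cancel from [gramS], whatever the
     dimensions. *)
  pose D := real_diag (fun j => (1 - alpha j)^-1).
  have mulKD : real_diag (fun j => 1 - alpha j) *m D = 1%:M.
    rewrite mul_real_diag -real_diag1; apply: eq_real_diag => j.
    by rewrite mulfV // gt_eqF.
  by rewrite /orthonormal_cols -[LHS]mulmx1 -mulKD mulmxA gramS.
Qed.
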